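(* For all $1\le k\le n$ the formulas $$\tilde\Theta^*_{n,k}:=\Big[\bigotimes_{i,j<n}((p_{i,j}\wedge1)\vee(q_{i,j}\wedge1))\Big]\to\Big(\Big[\bigotimes_{i<n,\,l<k}((s_{i,l}\wedge1)\vee(s'_{i,l}\wedge1))\to\alpha^k_n(\bar p,\bar s,\bar s')\Big]\vee\Big[\bigotimes_{i<n,\,l<k+1}((r_{i,l}\wedge1)\vee(r'_{i,l}\wedge1))\to\beta^{k+1}_n(\bar q,\bar r,\bar r')\Big]\Big)$$ are provable in $\mathbf{CFL_e^-}$. Moreover, putting $\tilde\Theta^*_n=\tilde\Theta^*_{n,\lfloor\sqrt n\rfloor}$, every $\mathbf{CFL_{ew}^-}$-proof of $\tilde\Theta^*_n$ contains at least $2^{\Omega(n^{1/4})}$ proof-lines, and hence has length exponential in terms of the length of $\tilde\Theta^*_n$.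
   Context: **Convention.** A quantity is exponential in terms of $N$ if it is bounded below by $2^{N^{\Omega(1)}}$. A proof-line is a sequent occurring in the proof; the length of a proof is its number of symbols; proofs may be dag-like. A proof of a formula $\phi$ in a sequent calculus is a proof of $(\Rightarrow\phi)$. **Formulas.** $\bigotimes$ denotes iterated fusion $*$ (indices in lexicographic order). The variables are $p_{i,j},q_{i,j}$ ($0\le i,j<n$), $s_{i,l},s'_{i,l}$ ($0\le i<n$, $0\le l<k$), $r_{i,l},r'_{i,l}$ ($0\le i<n$, $0\le l<k+1$), and $$\alpha^k_n(\bar p,\bar s,\bar s'):=\bigvee_{i<n}\bigwedge_{l<k}s'_{i,l}\ \vee\bigvee_{i,j<n}\bigvee_{l<k}(s_{i,l}\wedge s_{j,l}\wedge p_{i,j}),$$ $$\beta^{k+1}_n(\bar q,\bar r,\bar r'):=\bigvee_{l<k+1}\bigwedge_{i<n}r'_{i,l}\ \vee\bigvee_{i,j<n}\bigvee_{l<m<k+1}(r_{i,l}\wedge r_{j,m}\wedge q_{i,j}).$$ **The calculi $\mathbf{CFL_e^-}$ and $\mathbf{CFL_{ew}^-}$** over the language $\{\wedge,\vee,*,\to,0,1\}$. Sequents $\Gamma\Rightarrow\Delta$ with $\Gamma,\Delta$ finite (possibly empty) sequences of formulas. Initial sequents: $\phi\Rightarrow\phi$; $\Rightarrow1$; $0\Rightarrow$. Rules of $\mathbf{CFL_e^-}$ (premises / conclusion): exchange: $\Gamma,\phi,\psi,\Sigma\Rightarrow\Delta$ / $\Gamma,\psi,\phi,\Sigma\Rightarrow\Delta$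 and $\Gamma\Rightarrow\Delta,\phi,\psi,\Lambda$ / $\Gamma\Rightarrow\Delta,\psi,\phi,\Lambda$; $(1w)$ $\Gamma,\Sigma\Rightarrow\Delta$ / $\Gamma,1,\Sigma\Rightarrow\Delta$; $(0w)$ $\Gamma\Rightarrow\Delta,\Lambda$ / $\Gamma\Rightarrow\Delta,0,\Lambda$; $(L\wedge)$ $\Gamma,\phi,\Sigma\Rightarrow\Delta$ (or $\Gamma,\psi,\Sigma\Rightarrow\Delta$) / $\Gamma,\phi\wedge\psi,\Sigma\Rightarrow\Delta$; $(R\wedge)$ $\Gamma\Rightarrow\Delta,\phi,\Lambda$ and $\Gamma\Rightarrow\Delta,\psi,\Lambda$ / $\Gamma\Rightarrow\Delta,\phi\wedge\psi,\Lambda$; $(L\vee)$ $\Gamma,\phi,\Sigma\Rightarrow\Delta$ and $\Gamma,\psi,\Sigma\Rightarrow\Delta$ / $\Gamma,\phi\vee\psi,\Sigma\Rightarrow\Delta$; $(R\vee)$ $\Gamma\Rightarrow\Delta,\phi,\Lambda$ (or $\Gamma\Rightarrow\Delta,\psi,\Lambda$) / $\Gamma\Rightarrow\Delta,\phi\vee\psi,\Lambda$; $(L* )$ $\Gamma,\phi,\psi,\Sigma\Rightarrow\Delta$ / $\Gamma,\phi*\psi,\Sigma\Rightarrow\Delta$; $(R* )$ $\Gamma\Rightarrow\Delta,\phi,\Lambda$ and $\Sigma\Rightarrow\Delta,\psi,\Lambda$ / $\Gamma,\Sigma\Rightarrow\Delta,\phi*\psi,\Lambda$; $(L\to)$ $\Gamma\Rightarrow\phi,\Lambda$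 and $\Pi,\psi,\Sigma\Rightarrow\Delta$ / $\Pi,\Gamma,\phi\to\psi,\Sigma\Rightarrow\Delta,\Lambda$; $(R\to)$ $\phi,\Gamma\Rightarrow\psi,\Delta$ / $\Gamma\Rightarrow\phi\to\psi,\Delta$. There is no cut rule (this is the meaning of the superscript $-$). $\mathbf{CFL_{ew}^-}$ additionally has the weakening rules $\Gamma,\Sigma\Rightarrow\Delta$ / $\Gamma,\phi,\Sigma\Rightarrow\Delta$ and $\Gamma\Rightarrow\Delta,\Lambda$ / $\Gamma\Rightarrow\Delta,\phi,\Lambda$. *)

(* Defs.v *)
From HB Require Import structures.
From mathcomp Require Import all_boot all_order all_algebra.
From mathcomp Require Import reals exp.

Set Implicit Arguments.
Unset Strict Implicit.
Unset Printing Implicit Defensive.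

(* The primed families s', r' are written vs', vr'. *)
Inductive var : Type :=
  | vp of nat & nat | vq of nat & nat
  | vs of nat & nat | vs' of nat & nat
  | vr of nat & nat | vr' of nat & nat.

Inductive formula : Type :=
  | Var of var
  | One
  | Zero
  | And of formula & formula
  | Or of formula & formula
  | Fus of formula & formula
  | Imp of formula & formula.

Definition var_code (v : var) : nat * (nat * nat) :=
  match v with
  | vp i j => (0, (i, j)) | vq i j => (1, (i, j))
  | vs i j => (2, (i, j)) | vs' i j => (3, (i, j))
  | vr i j => (4, (i, j)) | vr' i j => (5, (i, j))
  end.

Definition var_decode (c : nat * (nat * nat)) : var :=
  let: (t, (i, j)) := c in
  match t with
  | 0 => vp i j | 1 => vq i j | 2 => vs i j | 3 => vs' i j | 4 => vr i j
  | _ => vr' i j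
  end.

Lemma var_codeK : cancel var_code var_decode.
Proof. by case. Qed.

HB.instance Definition _ := Countable.copy var (can_type var_codeK).

Fixpoint formula_code (f : formula) : GenTree.tree var :=
  match f with
  | Var v => GenTree.Leaf v
  | One => GenTree.Node 0 [::]
  | Zero => GenTree.Node 1 [::]
  | And a b => GenTree.Node 2 [:: formula_code a; formula_code b]
  | Or a b => GenTree.Node 3 [:: formula_code a; formula_code b]
  | Fus a b => GenTree.Node 4 [:: formula_code a; formula_code b]
  | Imp a b => GenTree.Node 5 [:: formula_code a; formula_code b]
  end.

Fixpoint formula_decode (t : GenTree.tree var) : formula :=
  match t with
  | GenTree.Leaf v => Var v
  | GenTree.Node 0 [::] => One
  | GenTree.Node 2 [:: a; b] => And (formula_decode a) (formula_decode b)
  | GenTree.Node 3 [:: a; b] => Or (formula_decode a) (formula_decode b)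
  | GenTree.Node 4 [:: a; b] => Fus (formula_decode a) (formula_decode b)
  | GenTree.Node 5 [:: a; b] => Imp (formula_decode a) (formula_decode b)
  | _ => Zero
  end.

Lemma formula_codeK : cancel formula_code formula_decode.
Proof. by elim=> //= a -> b ->. Qed.

HB.instance Definition _ := Countable.copy formula (can_type formula_codeK).

(* [(G, D)] is the sequent G => D. *)
Definition sequent : Type := (seq formula * seq formula)%type.

(* [CFLe_rule ps s]: s follows from the list of premises ps by one inference;
   initial sequents have no premises. There is no cut. In [fusR] the two
   premises share the right-hand context D, L. *)
Inductive CFLe_rule : seq sequent -> sequent -> Prop :=
  | init_id a : CFLe_rule [::] ([:: a], [:: a])
  | init_one : CFLe_rule [::] ([::], [:: One])
  | init_zero : CFLe_rule [::] ([:: Zero], [::])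
  | exchL G S D a b :
      CFLe_rule [:: (G ++ [:: a; b] ++ S, D)] (G ++ [:: b; a] ++ S, D)
  | exchR G D L a b :
      CFLe_rule [:: (G, D ++ [:: a; b] ++ L)] (G, D ++ [:: b; a] ++ L)
  | oneW G S D :
      CFLe_rule [:: (G ++ S, D)] (G ++ [:: One] ++ S, D)
  | zeroW G D L :
      CFLe_rule [:: (G, D ++ L)] (G, D ++ [:: Zero] ++ L)
  | andL1 G S D a b :
      CFLe_rule [:: (G ++ [:: a] ++ S, D)] (G ++ [:: And a b] ++ S, D)
  | andL2 G S D a b :
      CFLe_rule [:: (G ++ [:: b] ++ S, D)] (G ++ [:: And a b] ++ S, D)
  | andR G D L a b :
      CFLe_rule [:: (G, D ++ [:: a] ++ L); (G, D ++ [:: b] ++ L)]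
                (G, D ++ [:: And a b] ++ L)
  | orL G S D a b :
      CFLe_rule [:: (G ++ [:: a] ++ S, D); (G ++ [:: b] ++ S, D)]
                (G ++ [:: Or a b] ++ S, D)
  | orR1 G D L a b :
      CFLe_rule [:: (G, D ++ [:: a] ++ L)] (G, D ++ [:: Or a b] ++ L)
  | orR2 G D L a b :
      CFLe_rule [:: (G, D ++ [:: b] ++ L)] (G, D ++ [:: Or a b] ++ L)
  | fusL G S D a b :
      CFLe_rule [:: (G ++ [:: a; b] ++ S, D)] (G ++ [:: Fus a b] ++ S, D)
  | fusR G S D L a b :
      CFLe_rule [:: (G, D ++ [:: a] ++ L); (S, D ++ [:: b] ++ L)]
                (G ++ S, D ++ [:: Fus a b] ++ L)
  | impL G P S D L a b :
      CFLe_rule [:: (G, a :: L); (P ++ [:: b] ++ S, D)]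
                (P ++ G ++ [:: Imp a b] ++ S, D ++ L)
  | impR G D a b :
      CFLe_rule [:: (a :: G, b :: D)] (G, Imp a b :: D).

Inductive CFLew_rule : seq sequent -> sequent -> Prop :=
  | CFLew_of_CFLe ps s : CFLe_rule ps s -> CFLew_rule ps s
  | weakL G S D a : CFLew_rule [:: (G ++ S, D)] (G ++ [:: a] ++ S, D)
  | weakR G D L a : CFLew_rule [:: (G, D ++ L)] (G, D ++ [:: a] ++ L).

(* A dag-like proof of phi is the list of its lines: each one is inferred from
   earlier lines, which may be reused, and the last one is => phi. Since the
   default [([::], [::])] differs from => phi, the list is nonempty. *)
Definition is_proof (rule : seq sequent -> sequent -> Prop)
    (pf : seq sequent) (phi : formula) : Prop :=
  (forall i, i < size pf ->
     exists2 ps, rule ps (nth ([::], [::]) pf i) & {subset ps <= take i pf})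
  /\ last ([::], [::]) pf = ([::], [:: phi]).

Definition provable (rule : seq sequent -> sequent -> Prop)
    (phi : formula) : Prop :=
  exists pf, is_proof rule pf phi.

(* Numbers of symbols. A variable is one symbol; a binary connective comes with
   a pair of parentheses; a sequent has its commas and its arrow. *)
Fixpoint formula_length (f : formula) : nat :=
  match f with
  | Var _ | One | Zero => 1
  | And a b | Or a b | Fus a b | Imp a b =>
      formula_length a + formula_length b + 3
  end.

Definition sequent_length (s : sequent) : nat :=
  sumn (map formula_length s.1) + (size s.1).-1 + 1
  + sumn (map formula_length s.2) + (size s.2).-1.

Definition proof_length (pf : seq sequent) : nat :=
  sumn (map sequent_length pf).

(* Iterated connective, nested to the right and without a trailing unit; the
   value [e] on the empty list plays no role when 1 <= k <= n. *)
Fixpoint iter_conn (op : formula -> formula -> formula) (e : formula)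
    (s : seq formula) : formula :=
  match s with
  | [::] => e
  | [:: a] => a
  | a :: s' => op a (iter_conn op e s')
  end.

Notation bigAnd := (iter_conn And One).
Notation bigOr := (iter_conn Or Zero).
Notation bigFus := (iter_conn Fus One).

Definition alpha (n k : nat) : formula :=
  Or (bigOr [seq bigAnd [seq Var (vs' i l) | l <- iota 0 k] | i <- iota 0 n])
     (bigOr [seq bigOr [seq And (And (Var (vs i l)) (Var (vs j l)))
                                (Var (vp i j))
                       | l <- iota 0 k]
            | i <- iota 0 n, j <- iota 0 n]).

(* [iota l.+1 (k - l.+1)] lists the m with l < m < k. *)
Definition beta (n k : nat) : formula :=
  Or (bigOr [seq bigAnd [seq Var (vr' i l) | i <- iota 0 n] | l <- iota 0 k])
     (bigOr [seq bigOr [seq And (And (Var (vr i l)) (Var (vr j m)))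
                                (Var (vq i j))
                       | l <- iota 0 k, m <- iota l.+1 (k - l.+1)]
            | i <- iota 0 n, j <- iota 0 n]).

Definition choice1 (x y : var) : formula :=
  Or (And (Var x) One) (And (Var y) One).

Definition Theta (n k : nat) : formula :=
  Imp (bigFus [seq choice1 (vp i j) (vq i j) | i <- iota 0 n, j <- iota 0 n])
      (Or (Imp (bigFus [seq choice1 (vs i l) (vs' i l)
                       | i <- iota 0 n, l <- iota 0 k])
               (alpha n k))
          (Imp (bigFus [seq choice1 (vr i l) (vr' i l)
                       | i <- iota 0 n, l <- iota 0 k.+1])
               (beta n k.+1))).

(* [Nat.sqrt] is the floor of the square root. *)
Definition Theta_sqrt (n : nat) : formula := Theta n (Nat.sqrt n).

(* Main.v *)
(* Lower bound: cut-freeness and the absence of contraction on the left make the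
   lines G => B \/ C of a proof (B \/ C the succedent of Theta) a read-once
   decision dag: going upwards, the proof queries pairs (i, j), learns p_ij or q_ij, and may forget, but it never
   queries a pair twice. An adversary answers the first t ~ k/2 genuinely new queries
   arbitrarily (and all loops and reversed pairs by q). If an answered pair uv
   were forgotten, u, v and k-1 untouched vertices would form a (k+1)-clique up to
   uv while the p-edges together with this clique minus uv are k-colourable with u
   and v alike; since uv is then neither p nor q, this refutes the line
   classically. So every answer is remembered and the 2^t answer patterns lead to
   2^t distinct lines. No circuit lower bound is needed.

   Provability: resolve all choices; for each resulting graph the pigeonhole
   principle tells which of the two disjuncts to prove. *)

Require Import Defs.
From mathcomp Require Import all_boot all_order all_algebra.
From mathcomp Require Import boolp reals exp zify.

Set Implicit Arguments.
Unset Strict Implicit.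
Unset Printing Implicit Defensive.

Import Order.TTheory GRing.Theory Num.Theory.

(** * Classical semantics and soundness of the rules *)

Fixpoint eval (v : var -> bool) (f : formula) : bool :=
  match f with
  | Var x => v x
  | One => true
  | Zero => false
  | And a b | Fus a b => eval v a && eval v b
  | Or a b => eval v a || eval v b
  | Imp a b => eval v a ==> eval v b
  end.

Definition valid (s : sequent) : Prop :=
  forall v, all (eval v) s.1 -> has (eval v) s.2.

(** With fusion read as conjunction, every rule preserves classical truth. Each whole context counts
    as one Boolean, so each rule is a truth table. *)
Lemma CFLew_rule_sound ps s :
  CFLew_rule ps s -> {in ps, forall p, valid p} -> valid s.
Proof.
have two (p q : sequent) : {in [:: p; q], forall r, valid r} -> valid p /\ valid q.
  by move=> H; split; apply: H; rewrite !inE eqxx ?orbT.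
have one (p : sequent) : {in [:: p], forall r, valid r} -> valid p.
  by move=> H; apply: H; rewrite inE.
have bools := (all_cat, has_cat).
case=> [{}ps {}s|G S D a|G D L a]; first case;
  (* Introduce the parameters of a rule up to the hypothesis on its premises; then two, one or no
     premises are told apart. *)
  repeat lazymatch goal with |- prop_in1 _ _ -> _ => fail | _ => intro end;
  move=> H v; move: H;
  (tryif move=> /two[/(_ v) + /(_ v)] then idtac else
   tryif move=> /one/(_ v) then idtac else move=> _);
  rewrite /= ?bools /= ?bools;
  repeat match goal with
  | |- context [eval ?w ?a] => case: (eval w a)
  | |- context [all ?p ?l] => case: (all p l)
  | |- context [has ?p ?l] => case: (has p l)
  end => //=; by auto.
Qed.

Lemma eval_bigAnd v s : eval v (bigAnd s) = all (eval v) s.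
Proof. by elim: s => // a [|b s] IH; [rewrite /= andbT | rewrite [LHS]/= IH]. Qed.

Lemma eval_bigFus v s : eval v (bigFus s) = all (eval v) s.
Proof. by elim: s => // a [|b s] IH; [rewrite /= andbT | rewrite [LHS]/= IH]. Qed.

Lemma eval_bigOr v s : eval v (bigOr s) = has (eval v) s.
Proof. by elim: s => // a [|b s] IH; [rewrite /= orbF | rewrite [LHS]/= IH]. Qed.

(** * From derivation trees to dag-like proofs *)

(** Tree-like derivability, suited to building proofs from the goal upwards; [provable_of_derivable]
    flattens a tree into a list of lines. *)
Inductive derivable (rule : seq sequent -> sequent -> Prop) (s : sequent) : Prop :=
  Derivable ps of rule ps s & {in ps, forall p, derivable rule p}.

(** The condition of [is_proof] without its last line, which makes it stable under concatenation. *)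
Definition closed_lines (rule : seq sequent -> sequent -> Prop) (pf : seq sequent) :=
  forall i, i < size pf ->
    exists2 ps, rule ps (nth ([::], [::]) pf i) & {subset ps <= take i pf}.

Lemma closed_lines_cat rule pf1 pf2 :
  closed_lines rule pf1 -> closed_lines rule pf2 -> closed_lines rule (pf1 ++ pf2).
Proof.
move=> H1 H2 i; rewrite size_cat nth_cat take_cat => lti; case: ltnP => [|lei].
  exact: H1.
have [|ps ? sub] := H2 (i - size pf1); first by rewrite ltn_subLR.
by exists ps => // p /sub; rewrite mem_cat orbC => ->.
Qed.

Lemma closed_lines_rcons rule pf ps s :
  closed_lines rule pf -> rule ps s -> {subset ps <= pf} ->
  closed_lines rule (rcons pf s).
Proof.
move=> Hpf r sub i; rewrite size_rcons ltnS leq_eqVlt nth_rcons -cats1.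
case/orP=> [/eqP->|lti].
  by rewrite ltnn eqxx; exists ps => //; rewrite takel_cat // take_size.
by rewrite lti takel_cat ?(ltnW lti) //; apply: Hpf.
Qed.

Lemma provable_of_derivable rule phi :
  derivable rule ([::], [:: phi]) -> provable rule phi.
Proof.
suff main s : derivable rule s -> exists pf, closed_lines rule (rcons pf s).
  by move=> /main[pf Hpf]; exists (rcons pf ([::], [:: phi])); rewrite /is_proof last_rcons.
elim=> {}s ps r _ IH.
suff [pf Hpf sub] : exists2 pf, closed_lines rule pf & {subset ps <= pf}.
  by exists pf; apply: closed_lines_rcons r sub.
elim: ps IH {r} => [|p ps IHps] IH; first by exists [::].
have [|pf1 H1 sub1] := IHps; first by move=> q qin; apply: IH; rewrite inE qin orbT.
have [|pf2 H2] := IH p; first exact: mem_head.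
exists (pf1 ++ rcons pf2 p); first exact: closed_lines_cat.
move=> q; rewrite inE mem_cat => /orP[/eqP->|/sub1->//].
by rewrite mem_rcons mem_head orbT.
Qed.

Lemma derivable1 rule p s : rule [:: p] s -> derivable rule p -> derivable rule s.
Proof. by move=> r Hp; apply: Derivable r _ => q; rewrite inE => /eqP->. Qed.

Lemma derivable2 rule p q s :
  rule [:: p; q] s -> derivable rule p -> derivable rule q -> derivable rule s.
Proof. by move=> r Hp Hq; apply: Derivable r _ => ?; rewrite !inE => /orP[]/eqP->. Qed.

(** * Provability of Theta by resolving the choices *)

Definition lits (X : seq var) : seq formula := [seq And (Var x) One | x <- X].

(** The conjunct [One] stands in for weakening: read upwards, [andL2] turns a literal into [One] and
    [oneW] deletes it. *)
Lemma derivable_drop_lits X Y G D :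
  derivable CFLe_rule (G, D) -> derivable CFLe_rule (lits X ++ G ++ lits Y, D).
Proof.
move=> H; elim: X => [|x X IH] /=; last first.
  by apply: derivable1 (andL2 [::] _ _ _ _) _; apply: derivable1 (oneW [::] _ _) _.
elim/last_ind: Y => [|Y y IH]; first by rewrite /= cats0.
rewrite /lits map_rcons -cats1 catA -/(lits Y).
by apply: derivable1 (andL2 _ [::] _ _ _) _; apply: derivable1 (oneW _ [::] _) _; rewrite cats0.
Qed.

Fixpoint and_or (f : formula) : bool :=
  match f with
  | Var _ | One | Zero => true
  | And a b | Or a b => and_or a && and_or b
  | Fus _ _ | Imp _ _ => false
  end.

Lemma derivable_and_or X f :
  and_or f -> eval (mem X) f -> derivable CFLe_rule (lits X, [:: f]).
Proof.
elim: f => //= [x _|_ _|a IHa b IHb|a IHa b IHb].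
- case/splitPr=> X1 X2; rewrite /lits map_cat /=.
  apply: derivable1 (andL1 _ _ _ _ _) _.
  by apply: derivable_drop_lits; apply: Derivable (init_id _) _.
- by rewrite -[lits X]cats0; apply: (@derivable_drop_lits _ [::] [::]);
    apply: Derivable init_one _.
- move=> /andP[oa ob] /andP[va vb].
  by apply: derivable2 (andR _ [::] [::] _ _) _ _; [apply: IHa|apply: IHb].
- move=> /andP[oa ob] /orP[va|vb].
    by apply: derivable1 (orR1 _ [::] [::] _ _) _; apply: IHa.
  by apply: derivable1 (orR2 _ [::] [::] _ _) _; apply: IHb.
Qed.

Definition covers (Y : seq var) (cs : seq (var * var)) : bool :=
  all (fun c => (c.1 \in Y) || (c.2 \in Y)) cs.

Definition choices (cs : seq (var * var)) : formula :=
  bigFus [seq choice1 c.1 c.2 | c <- cs].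

Lemma coversW x Y cs : covers Y cs -> covers (x :: Y) cs.
Proof. by apply: sub_all => c; rewrite !inE => /orP[]->; rewrite !orbT. Qed.

(** Read upwards, [fusL] detaches the first choice and [orL] answers it; the induction collects the
    answers in the prefix [X]. *)
Lemma derivable_choices cs X Z D :
  (forall Y, covers Y cs -> derivable CFLe_rule (lits (X ++ Y ++ Z), D)) ->
  derivable CFLe_rule (lits X ++ choices cs :: lits Z, D).
Proof.
elim: cs X => [|[x y] cs IH] X H.
  by apply: derivable1 (oneW _ _ _) _; rewrite /lits -map_cat; apply: (H [::]).
have {}IH : forall z, z \in [:: x; y] -> derivable CFLe_rule
    (lits X ++ [:: And (Var z) One; choices cs] ++ lits Z, D).
  move=> z zin; rewrite -cat1s -catA catA -[_ ++ [:: _]]/(lits X ++ lits [:: z]).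
  rewrite -map_cat; apply: IH => Y cY; rewrite -catA; apply: (H (z :: Y)).
  rewrite /covers /= -/(covers _ _) (coversW _ cY) andbT !inE.
  by move: zin; rewrite !inE => /orP[]/eqP->; rewrite eqxx ?orbT.
have split F : (forall z, z \in [:: x; y] -> derivable CFLe_rule
      (lits X ++ [:: And (Var z) One] ++ F ++ lits Z, D)) ->
    derivable CFLe_rule (lits X ++ choice1 x y :: F ++ lits Z, D).
  by move=> HF; apply: derivable2 (orL _ _ _ _ _) _ _; apply: HF; rewrite !inE eqxx ?orbT.
(* [bigFus] has no trailing unit: the last choice stands alone and takes no [fusL]. *)
case: cs IH H => [|c cs] IH H.
  apply: (split [::]) => z zin; rewrite -[[:: _]]/(lits [:: z]) cat0s /lits -!map_cat.
  apply: H; rewrite /covers /= andbT !inE; move: zin.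
  by rewrite !inE => /orP[]/eqP->; rewrite eqxx ?orbT.
apply: derivable1 (fusL _ _ _ _ _) _; apply: (split [:: choices (c :: cs)]) => z.
exact: IH.
Qed.

Lemma eval_choices v cs : eval v (choices cs) = all (fun c => v c.1 || v c.2) cs.
Proof.
by rewrite /choices eval_bigFus all_map; apply: eq_all => c; rewrite /= !andbT.
Qed.

(** When every pair s, s' has a true member, failure of alpha makes s contain a proper [k]-colouring
    of the graph p. *)
Lemma alphaPn v n k :
  ~~ eval v (alpha n k) <->
  (forall i, i < n -> exists2 l, l < k & ~~ v (vs' i l)) /\
  (forall i j l, i < n -> j < n -> l < k -> v (vs i l) -> v (vs j l) -> ~~ v (vp i j)).
Proof.
rewrite /= !eval_bigOr negb_or; split.
  case/andP=> /hasPn H1 /hasPn H2; split=> [i ltin|i j l ltin ltjn ltlk vi vj].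
    have /H1 : bigAnd [seq Var (vs' i l) | l <- iota 0 k]
      \in [seq bigAnd [seq Var (vs' i l) | l <- iota 0 k] | i <- iota 0 n].
      by apply: map_f; rewrite mem_iota.
    rewrite eval_bigAnd all_map => /allPn[l]; rewrite mem_iota => ltlk; by exists l.
  have {H2} := H2 _ (allpairs_f _ (_ : i \in iota 0 n) (_ : j \in iota 0 n)).
  rewrite !mem_iota => /(_ ltin ltjn); rewrite eval_bigOr => /hasPn H.
  have := H _ (map_f _ (_ : l \in iota 0 k)); rewrite mem_iota => /(_ ltlk) /=.
  by rewrite vi vj.
case=> H1 H2; apply/andP; split; apply/hasPn => f.
  case/mapP=> i; rewrite mem_iota => ltin ->; rewrite eval_bigAnd all_map.
  have [l ltlk Hl] := H1 i ltin; apply/allPn; exists l => //; by rewrite mem_iota.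
case/allpairsP=> -[i j] /= []; rewrite !mem_iota => ltin ltjn ->.
rewrite eval_bigOr; apply/hasPn => g /mapP[l]; rewrite mem_iota => ltlk -> /=.
by apply/negP => /andP[/andP[vi vj]]; apply/negP; apply: H2 vi vj.
Qed.

(** When every pair r, r' has a true member, failure of beta lets r pick a sequence of [k] vertices
    in which q joins no earlier one to a later one. *)
Lemma betaPn v n k :
  ~~ eval v (beta n k) <->
  (forall l, l < k -> exists2 i, i < n & ~~ v (vr' i l)) /\
  (forall i j l m, i < n -> j < n -> l < m < k -> v (vr i l) -> v (vr j m) ->
    ~~ v (vq i j)).
Proof.
have mem_iotaS l m : l < k -> (m \in iota l.+1 (k - l.+1)) = (l < m < k).
  by move=> ltlk; rewrite mem_iota subnKC.
rewrite /= !eval_bigOr negb_or; split.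
  case/andP=> /hasPn H1 /hasPn H2.
  split=> [l ltlk|i j l m ltin ltjn /andP[ltlm ltmk] vi vj].
    have /H1 : bigAnd [seq Var (vr' i l) | i <- iota 0 n]
      \in [seq bigAnd [seq Var (vr' i l) | i <- iota 0 n] | l <- iota 0 k].
      by apply: map_f; rewrite mem_iota.
    rewrite eval_bigAnd all_map => /allPn[i]; rewrite mem_iota => ltin; by exists i.
  have {H2} := H2 _ (allpairs_f _ (_ : i \in iota 0 n) (_ : j \in iota 0 n)).
  rewrite !mem_iota => /(_ ltin ltjn); rewrite eval_bigOr => /hasPn H.
  have ltlk := ltn_trans ltlm ltmk.
  have := H _ (allpairs_f_dep _ (_ : l \in iota 0 k) (_ : m \in iota l.+1 (k - l.+1))).
  by rewrite mem_iotaS // ltlm mem_iota => /(_ ltlk ltmk) /=; rewrite vi vj.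
case=> H1 H2; apply/andP; split; apply/hasPn => f.
  case/mapP=> l; rewrite mem_iota => ltlk ->; rewrite eval_bigAnd all_map.
  have [i ltin Hi] := H1 l ltlk; apply/allPn; exists i => //; by rewrite mem_iota.
case/allpairsP=> -[i j] /= []; rewrite !mem_iota => ltin ltjn ->.
rewrite eval_bigOr; apply/hasPn => g /allpairsPdep[l [m []]].
rewrite mem_iota => ltlk; rewrite mem_iotaS // => ltlmk -> /=.
by apply/negP => /andP[/andP[vi vj]]; apply/negP; apply: H2 ltlmk vi vj.
Qed.

Definition edge_choices (n : nat) : seq (var * var) :=
  [seq (vp i j, vq i j) | i <- iota 0 n, j <- iota 0 n].
Definition colour_choices (n k : nat) : seq (var * var) :=
  [seq (vs i l, vs' i l) | i <- iota 0 n, l <- iota 0 k].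
Definition clique_choices (n k : nat) : seq (var * var) :=
  [seq (vr i l, vr' i l) | i <- iota 0 n, l <- iota 0 k].

Lemma ThetaE n k :
  Theta n k = Imp (choices (edge_choices n))
    (Or (Imp (choices (colour_choices n k)) (alpha n k))
        (Imp (choices (clique_choices n k.+1)) (beta n k.+1))).
Proof. by rewrite /choices !map_allpairs. Qed.

Lemma and_or_bigAnd s : and_or (bigAnd s) = all and_or s.
Proof. by elim: s => // a [|b s] IH; [rewrite /= andbT | rewrite [LHS]/= IH]. Qed.

Lemma and_or_bigOr s : and_or (bigOr s) = all and_or s.
Proof. by elim: s => // a [|b s] IH; [rewrite /= andbT | rewrite [LHS]/= IH]. Qed.

Lemma and_or_alpha n k : and_or (alpha n k).
Proof.
rewrite /= !and_or_bigOr; apply/andP; split; apply/allP => f.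
  by case/mapP=> i _ ->; rewrite and_or_bigAnd; apply/allP => g /mapP[l _ ->].
by case/allpairsP=> ij [_ _ ->]; rewrite and_or_bigOr; apply/allP => g /mapP[l _ ->].
Qed.

Lemma and_or_beta n k : and_or (beta n k).
Proof.
rewrite /= !and_or_bigOr; apply/andP; split; apply/allP => f.
  by case/mapP=> i _ ->; rewrite and_or_bigAnd; apply/allP => g /mapP[l _ ->].
case/allpairsP=> ij [_ _ ->]; rewrite and_or_bigOr; apply/allP => g.
by case/allpairsPdep=> [l [m [_ _ ->]]].
Qed.

(** Pigeonhole: two of the [k.+1] picked vertices share one of the [k] colours, and their pair is p,
    against the colouring, or q, against the clique. *)
Lemma alpha_or_beta n k Y Ys Yr :
  covers Y (edge_choices n) -> covers Ys (colour_choices n k) ->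
  covers Yr (clique_choices n k.+1) ->
  eval (mem (Ys ++ Y)) (alpha n k) || eval (mem (Yr ++ Y)) (beta n k.+1).
Proof.
move=> /all_allpairsP cY /all_allpairsP cYs /all_allpairsP cYr.
apply/negPn; rewrite negb_or; apply/negP => /andP[].
move=> /alphaPn[Ha1 Ha2] Hb; have [Hb1 Hb2] := (betaPn _ _ _).1 Hb.
have /choice[col Hcol] : forall i, exists l, i < n -> l < k /\ vs i l \in Ys ++ Y.
  move=> i.
  have [ltin|] := ltnP i n; last by exists 0.
  have [l ltlk Hl] := Ha1 i ltin; exists l => _; split=> //; move: Hl.
  have := cYs i l; rewrite !mem_iota => /(_ ltin ltlk).
  by rewrite /= !mem_cat => /orP[->//|->].
have /choice[ver Hver] : forall l, exists i, l < k.+1 ->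
    i < n /\ vr i l \in Yr ++ Y.
  move=> l.
  have [ltlk|] := ltnP l k.+1; last by exists 0.
  have [i ltin Hi] := Hb1 l ltlk; exists i => _; split=> //; move: Hi.
  have := cYr i l; rewrite !mem_iota => /(_ ltin ltlk).
  by rewrite /= !mem_cat => /orP[->//|->].
have inj l m : l < m < k.+1 -> col (ver l) != col (ver m).
  move=> /andP[ltlm ltmk]; have ltlk := ltn_trans ltlm ltmk.
  have [ltl vl] := Hver l ltlk; have [ltm vm] := Hver m ltmk.
  have [cl sl] := Hcol _ ltl; have [cm sm] := Hcol _ ltm.
  apply/eqP => E; rewrite -E in sm.
  have := Hb2 _ _ l m ltl ltm; rewrite ltlm => /(_ ltmk vl vm) /=.
  have := Ha2 _ _ _ ltl ltm cl sl sm; rewrite /= !mem_cat.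
  have := cY (ver l) (ver m); rewrite !mem_iota => /(_ ltl ltm).
  by case/orP=> ->; rewrite orbT.
have /(uniq_leq_size _) : {subset [seq col (ver l) | l <- iota 0 k.+1] <= iota 0 k}.
  move=> c /mapP[l]; rewrite mem_iota => ltlk ->; rewrite mem_iota.
  by have [/Hcol[]] := Hver l ltlk.
rewrite size_map !size_iota ltnn => uniq_false; apply/notF/uniq_false.
rewrite map_inj_in_uniq ?iota_uniq //.
move=> l m; rewrite !mem_iota /= => ltlk ltmk E.
case: (ltngtP l m) => // lt; [have := inj l m|have := inj m l]; rewrite lt E eqxx.
  by move/(_ ltmk).
by move/(_ ltlk).
Qed.

(** The edge answers [Y] are fixed before a disjunct is chosen. If some colour answers [Ys] falsify
    alpha, then beta holds for all clique answers [Yr], so one side always works. *)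
Lemma derivable_Theta n k : derivable CFLe_rule ([::], [:: Theta n k]).
Proof.
rewrite ThetaE; apply: derivable1 (impR _ _ _ _) _.
apply: (@derivable_choices _ [::] [::]) => Y cY; rewrite cats0.
have [Hs|/existsNP[Ys /not_implyP[cYs /negP Hs]]] := pselect (forall Ys,
    covers Ys (colour_choices n k) -> eval (mem (Ys ++ Y)) (alpha n k)).
  apply: derivable1 (orR1 _ [::] [::] _ _) _; apply: derivable1 (impR _ _ _ _) _.
  apply: (@derivable_choices _ [::] Y) => Ys /Hs.
  exact: derivable_and_or (and_or_alpha _ _).
apply: derivable1 (orR2 _ [::] [::] _ _) _; apply: derivable1 (impR _ _ _ _) _.
apply: (@derivable_choices _ [::] Y) => Yr cYr.
apply: derivable_and_or (and_or_beta _ _) _.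
by have := alpha_or_beta cY cYs cYr; rewrite (negPf Hs).
Qed.

(** * Edge statuses recorded in the antecedent of a line *)

(* The status of an edge in the antecedent of a line: [None] while its choice
   formula is unresolved, [Some true] for p, [Some false] for q. *)
Fixpoint content (f : formula) : seq ((nat * nat) * option bool) :=
  match f with
  | Var (vp i j) | And (Var (vp i j)) _ => [:: ((i, j), Some true)]
  | Var (vq i j) | And (Var (vq i j)) _ => [:: ((i, j), Some false)]
  | Or (And (Var (vp i j)) _) _ => [:: ((i, j), None)]
  | Fus a b => content a ++ content b
  | _ => [::]
  end.

(** The formulas that arise on the left from the edge choices of Theta: the class is closed under
    reading the left rules upwards. *)
Fixpoint edge_formula (f : formula) : bool :=
  match f with
  | Var (vp _ _) | Var (vq _ _) | One
  | And (Var (vp _ _)) One | And (Var (vq _ _)) One => true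
  | Or (And (Var (vp i j)) One) (And (Var (vq i' j')) One) => (i == i') && (j == j')
  | Fus a b => edge_formula a && edge_formula b
  | _ => false
  end.

Definition contents (G : seq formula) := flatten (map content G).

Lemma contents_cat G S : contents (G ++ S) = contents G ++ contents S.
Proof. by rewrite /contents map_cat flatten_cat. Qed.

Lemma contents_cons a S : contents (a :: S) = content a ++ contents S.
Proof. by []. Qed.

Lemma edge_formula_And a b :
  edge_formula (And a b) ->
  [/\ edge_formula a, content (And a b) = content a & b = One].
Proof. by case: a => // -[] // i j; case: b. Qed.

Lemma edge_formula_Or a b :
  edge_formula (Or a b) ->
  exists e, [/\ edge_formula a, edge_formula b, content (Or a b) = [:: (e, None)],
    content a = [:: (e, Some true)] & content b = [:: (e, Some false)]].
Proof.
case: a => // -[] // -[] // i j [] //; case: b => // -[] // -[] // i' j' [] //=.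
by move=> /andP[/eqP<- /eqP<-]; exists (i, j).
Qed.

Lemma cat_cons_eq1 (T : Type) (D L : seq T) x y :
  [:: y] = D ++ x :: L -> [/\ D = [::], L = [::] & y = x].
Proof. by case: D => [[-> ->]|z [] // _ []] //. Qed.

(* Reading a line upwards, one either loses information, resolves the status of
   an edge, or commits to one side of the succedent. No edge status is ever
   duplicated, because there is no contraction. *)
Lemma CFLew_rule_edges ps G B C :
  CFLew_rule ps (G, [:: Or B C]) -> all edge_formula G -> ~~ edge_formula (Or B C) ->
  [\/ exists G' c, [/\ (G', [:: Or B C]) \in ps, all edge_formula G' &
        perm_eq (contents G) (contents G' ++ c)],
      exists e c G1 G0, [/\ (G1, [:: Or B C]) \in ps, (G0, [:: Or B C]) \in ps,
        all edge_formula G1 && all edge_formula G0,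
        perm_eq (contents G) ((e, None) :: c) &
        perm_eq (contents G1) ((e, Some true) :: c) /\
        perm_eq (contents G0) ((e, Some false) :: c)] |
      exists2 D, (G, D) \in ps & D \in [:: [:: B]; [:: C]; [::]]].
Proof.
have permc : forall c1 c2 : seq ((nat * nat) * option bool),
    (forall x, count x c1 = count x c2) -> perm_eq c1 c2.
  by move=> c1 c2 H; apply/permP => x.
move E: (G, _) => s H; case: H E => [{}ps {}s []|G1 S D a|G1 D L a].
(* The identity axiom would put [Or B C] itself on the left. *)
- by move=> a [-> <-] /=; rewrite andbT => ->.
- by [].
- by [].
- move=> G1 S D a b [-> <-]; rewrite !all_cat /= => okG _; apply: Or31.
  exists (G1 ++ [:: a; b] ++ S), [::]; split; first exact: mem_head.
    by rewrite !all_cat /=; move: okG; case: (all _ G1); case: (edge_formula a);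
      case: (edge_formula b).
  rewrite !contents_cat !contents_cons; apply: permc => x; rewrite !count_cat /=; lia.
- by move=> G1 D L a b [_ E]; case: (cat_cons_eq1 E).
- move=> G1 S D [-> <-]; rewrite !all_cat /= => okG _; apply: Or31.
  exists (G1 ++ S), [::]; split; first exact: mem_head; first by rewrite all_cat.
  by rewrite !contents_cat contents_cons cats0.
- by move=> G1 D L [_ E]; case: (cat_cons_eq1 E).
- move=> G1 S D a b [-> <-]; rewrite !all_cat [all _ (And _ _ :: _)]/= -/(edge_formula (And a b)).
  move=> /and3P[ok1 /edge_formula_And[oka Ea _] okS] _; apply: Or31.
  exists (G1 ++ [:: a] ++ S), [::]; split; first exact: mem_head.
    by rewrite !all_cat /= ok1 oka okS.
  by rewrite !contents_cat !contents_cons Ea !cats0.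
(* Keeping only [One] forgets the status of the edge. *)
- move=> G1 S D a b [-> <-]; rewrite !all_cat [all _ (And _ _ :: _)]/= -/(edge_formula (And a b)).
  move=> /and3P[ok1 /edge_formula_And[oka Ea Eb] okS] _; subst b; apply: Or31.
  exists (G1 ++ [:: One] ++ S), (content a); split; first exact: mem_head.
    by rewrite !all_cat /= ok1 okS.
  rewrite !contents_cat !contents_cons Ea; apply: permc => x; rewrite !count_cat /=; lia.
- by move=> G1 D L a b [_ E]; case: (cat_cons_eq1 E).
- move=> G1 S D a b [-> <-]; rewrite !all_cat [all _ (Or _ _ :: _)]/= -/(edge_formula (Or a b)).
  move=> /and3P[ok1 /edge_formula_Or[e [oka okb Eab Ea Eb]] okS] _; apply: Or32.
  exists e, (contents (G1 ++ S)), (G1 ++ [:: a] ++ S), (G1 ++ [:: b] ++ S); split.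
  + exact: mem_head.
  + by rewrite !inE eqxx orbT.
  + by rewrite !all_cat /= ok1 oka okb okS.
  + rewrite !contents_cat !contents_cons Eab; apply: permc => x.
    rewrite /= ?count_cat /= ?count_cat; lia.
  + by split; rewrite !contents_cat !contents_cons ?Ea ?Eb; apply: permc => x;
      rewrite /= ?count_cat /= ?count_cat; lia.
- move=> G1 D L a b [-> E]; case: (cat_cons_eq1 E) => -> -> [<- _] _ _; apply: Or33.
  by exists [:: B]; [exact: mem_head|rewrite inE eqxx].
- move=> G1 D L a b [-> E]; case: (cat_cons_eq1 E) => -> -> [_ <-] _ _; apply: Or33.
  by exists [:: C]; [exact: mem_head|rewrite !inE eqxx ?orbT].
- move=> G1 S D a b [-> <-]; rewrite !all_cat /= => okG _; apply: Or31.
  exists (G1 ++ [:: a; b] ++ S), [::]; split; first exact: mem_head.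
    by move: okG; rewrite !all_cat /= andbT !andbA.
  rewrite !contents_cat !contents_cons; apply: permc => x; rewrite /= !count_cat /=; lia.
- by move=> G1 S D L a b [_ E]; case: (cat_cons_eq1 E).
(* An implication is no edge formula, so [impL] cannot have produced the line. *)
- by move=> G1 P S D L a b [-> _]; rewrite !all_cat /= !andbF.
- by [].
- move=> [-> <-]; rewrite !all_cat => /and3P[ok1 _ okS] _; apply: Or31.
  exists (G1 ++ S), (content a); split; first exact: mem_head; first by rewrite all_cat ok1.
  rewrite !contents_cat !contents_cons; apply: permc => x; rewrite !count_cat /=; lia.
- move=> [-> E]; case: (cat_cons_eq1 E) => -> -> _ _ _; apply: Or33.
  by exists [::]; [exact: mem_head|rewrite !inE eqxx !orbT].
Qed.

(** * Countermodels built from a colouring and a clique *)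

(** An unresolved edge is p on [K] and q elsewhere, while an edge absent from [c] is neither: this
    is the freedom gained once a status is forgotten. *)
Definition model (c : seq ((nat * nat) * option bool)) (K : pred (nat * nat))
    (col : nat -> nat) (cl : seq nat) (x : var) : bool :=
  match x with
  | vp i j => (((i, j), Some true) \in c) || (((i, j), None) \in c) && K (i, j)
  | vq i j => (((i, j), Some false) \in c) || (((i, j), None) \in c) && ~~ K (i, j)
  | vs i l => col i == l
  | vs' i l => col i != l
  | vr i l => nth 0 cl l == i
  | vr' i l => nth 0 cl l != i
  end.

Lemma model_contents G K col cl :
  all edge_formula G -> all (eval (model (contents G) K col cl)) G.
Proof.
suff main c f : edge_formula f -> {subset content f <= c} -> eval (model c K col cl) f.
  move=> /allP okG; apply/allP => f fG; apply: main; first exact: okG.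
  by move=> x xf; apply/flatten_mapP; exists f.
elim: f => //=.
- by case=> // i j _ /(_ _ (mem_head _ _)) /= ->.
- move=> a _ b _; case: a => // -[] // i j; case: b => //= _ /(_ _ (mem_head _ _)) -> //.
- move=> a _ b _; case: a => // -[] // -[] // i j [] //; case: b => // -[] // -[] // i' j' [] //=.
  by move=> /andP[/eqP<- /eqP<-] /(_ _ (mem_head _ _)) ->; case: (K _); rewrite ?orbT.
- move=> a IHa b IHb /andP[oka okb] sub; apply/andP; split.
    by apply: IHa => // x xa; apply: sub; rewrite mem_cat xa.
  by apply: IHb => // x xb; apply: sub; rewrite mem_cat xb orbT.
Qed.

Definition colour_side (n k : nat) := Imp (choices (colour_choices n k)) (alpha n k).
Definition clique_side (n k : nat) := Imp (choices (clique_choices n k.+1)) (beta n k.+1).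
Definition succedent (n k : nat) := Or (colour_side n k) (clique_side n k).

Lemma model_colour n k c K col cl :
  (forall i, i < n -> col i < k) ->
  (forall i j, model c K col cl (vp i j) -> col i != col j) ->
  ~~ eval (model c K col cl) (colour_side n k).
Proof.
move=> ltcol Hcol; rewrite -[eval _ _]/(eval _ (choices _) ==> eval _ (alpha n k)).
rewrite eval_choices negb_imply.
apply/andP; split; first by apply/all_allpairsP => i l _ _ /=; case: eqP.
apply/alphaPn; split=> [i ltin|i j l ltin ltjn ltlk /= /eqP <- /eqP Eij].
  by exists (col i); [exact: ltcol|rewrite /= eqxx].
by apply/negP => /Hcol; rewrite Eij eqxx.
Qed.

Lemma model_clique n k c K col cl :
  (forall l, l < k.+1 -> nth 0 cl l < n) ->
  (forall l m, l < m < k.+1 -> ~~ model c K col cl (vq (nth 0 cl l) (nth 0 cl m))) ->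
  ~~ eval (model c K col cl) (clique_side n k).
Proof.
move=> ltcl Hcl; rewrite -[eval _ _]/(eval _ (choices _) ==> eval _ (beta n k.+1)).
rewrite eval_choices negb_imply.
apply/andP; split; first by apply/all_allpairsP => i l _ _ /=; case: eqP.
apply/betaPn; split=> [l ltlk|i j l m _ _ ltlmk /= /eqP <- /eqP <-].
  by exists (nth 0 cl l); [exact: ltcl|rewrite /= eqxx].
exact: Hcl.
Qed.

(** * The adversary and its answers *)

Definition swap (e : nat * nat) := (e.2, e.1).

(* [T] lists the edges queried so far, with the answers of the adversary. *)
Definition good_answers (n : nat) (T : seq ((nat * nat) * bool)) : Prop :=
  uniq (unzip1 T) /\
  forall e, e \in unzip1 T ->
    [/\ e.1 < n, e.2 < n, e.1 != e.2 & swap e \notin unzip1 T].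

(** [T] may exceed what the antecedent shows, so forgetting keeps consistency. A p must have been
    answered in [T]; a q may also stem from a loop or a reversed pair, which get q by default. *)
Record consistent (n : nat) (T : seq ((nat * nat) * bool)) (G : seq formula) : Prop := {
  consistent_edge : all edge_formula G;
  consistent_uniq : uniq (unzip1 (contents G));
  consistent_lt : forall e, e \in unzip1 (contents G) -> (e.1 < n) && (e.2 < n);
  consistent_p : forall e, (e, Some true) \in contents G -> (e, true) \in T;
  consistent_q : forall e, (e, Some false) \in contents G ->
    [|| e.1 == e.2, (e, false) \in T | swap e \in unzip1 T];
  consistent_open : forall e, e \in unzip1 T -> (e, None) \notin contents G
}.

Definition touched (T : seq ((nat * nat) * bool)) : seq nat :=
  [seq a.1.1 | a <- T] ++ [seq a.1.2 | a <- T].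

Lemma size_touched T : size (touched T) = (size T).*2.
Proof. by rewrite size_cat !size_map addnn. Qed.

Lemma mem_touched T e : e \in unzip1 T -> (e.1 \in touched T) && (e.2 \in touched T).
Proof.
case/mapP=> a aT ->; rewrite !mem_cat; apply/andP.
by split; apply/orP; [left|right]; apply/mapP; exists a.
Qed.

Lemma fresh_vertices n m (tch : seq nat) :
  size tch + m <= n ->
  exists W, [/\ size W = m, uniq W & {in W, forall x, x < n /\ x \notin tch}].
Proof.
move=> le; pose F := [seq x <- iota 0 n | x \notin tch].
have leF : m <= size F.
  have := count_predC [in tch] (iota 0 n); rewrite size_iota size_filter.
  have : count [in tch] (iota 0 n) <= size tch.
    rewrite -size_filter uniq_leq_size ?filter_uniq ?iota_uniq // => x.
    by rewrite mem_filter => /andP[].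
  rewrite -[count (fun x => x \notin tch) _]/(count (predC [in tch]) _); lia.
exists (take m F); split; first exact: size_takel.
  by rewrite take_uniq // filter_uniq // iota_uniq.
by move=> x /mem_take; rewrite mem_filter mem_iota => /andP[].
Qed.

Lemma uniq_unzip1_inj (A B : eqType) (s : seq (A * B)) a b b' :
  uniq (unzip1 s) -> (a, b) \in s -> (a, b') \in s -> b = b'.
Proof.
elim: s => //= -[a1 b1] s IH /andP[/= notin us]; rewrite !inE !xpair_eqE.
have absurd c : (a1, c) \in s -> False.
  by move=> cs; case/negP: notin; apply: (map_f fst cs).
case/orP=> [/andP[/eqP-> /eqP->]|abs] /orP[/andP[/eqP E /eqP->]|abs'] //.
- by case: (absurd _ abs').
- by rewrite E in abs; case: (absurd _ abs).
- exact: IH.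
Qed.

(* If an answered edge uv were missing from the antecedent, then u, v and k-1
   untouched vertices would form a clique for beta, while colouring u and v
   alike refutes alpha. *)
Lemma answered_edge_remembered n k T G e :
  (size T).*2 < k -> (size T).*2 + k < n -> good_answers n T -> consistent n T G ->
  valid (G, [:: succedent n k]) -> e \in unzip1 T -> e \in unzip1 (contents G).
Proof.
move=> ltk ltn [uT goodT] consG validG eT; apply/negPn/negP => enotin.
have [okG uG ltG Hp Hq Hopen] := consG.
case: e eT enotin => u v eT enotin; have [/= ltun ltvn neuv _] := goodT _ eT.
have /andP[/= utch vtch] := mem_touched eT.
have := size_touched T; set tch := touched T => szt.
have [|W [szW uW HW]] := @fresh_vertices n k.-1 tch; first by lia.
have wnotin w : w \in tch -> w \notin W by move=> wt; apply/negP => /HW[_ /negP].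
pose cl := [:: u, v & W].
have ucl : uniq cl by rewrite /= inE negb_or neuv !wnotin.
have szcl : size cl = k.+1 by rewrite /= szW prednK //; lia.
(* As [size cl] is [k.+1], an index below [k.+1] means membership. Unresolved pairs in the clique
   are p in the order of the list, the only order that beta inspects. *)
pose K := [pred f : nat * nat | index f.1 cl < index f.2 cl < k.+1].
(* [u] and [v] share colour 0. Other touched vertices and [W] may reuse colours, because each p-edge
   lies within the touched vertices or within the clique. *)
pose col x := if x \in [:: u; v] then 0 else
  if x \in tch then (index x tch).+1 else
  if x \in W then (index x W).+1 else 0.
pose M := model (contents G) K col cl.
have in_cl x : x \in cl -> x \in [:: u; v] \/ x \in W.
  by rewrite -[cl]/([:: u; v] ++ W) mem_cat => /orP.
have touched_cl x : x \in cl -> x \in tch -> x \in [:: u; v].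
  by move=> /in_cl[//|xW] /wnotin/negP.
have uvE x y : x \in [:: u; v] -> y \in [:: u; v] -> index x cl < index y cl ->
    (x, y) = (u, v).
  rewrite !inE => /orP[]/eqP-> /orP[]/eqP->; rewrite /= ?eqxx ?ltnn //=.
have col_uv x : x \in [:: u; v] -> col x = 0 by rewrite /col => ->.
have col_W x : x \in W -> col x = (index x W).+1.
  move=> xW; have [_ /negPf xt] := HW x xW; rewrite /col xt xW.
  by case: ifP => //; rewrite !inE => /orP[]/eqP E; rewrite E ?utch ?vtch in xt.
have index_neq (s : seq nat) x y :
    x \in s -> y \in s -> x != y -> index x s != index y s.
  by move=> xs ys; apply: contraNN => /eqP E; apply/eqP/(index_inj 0 xs ys E).
have notuv i j st : ((i, j), st) \in contents G -> (i, j) != (u, v).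
  by move=> ijG; apply: contraNneq enotin => <-; apply: (map_f fst ijG).
have := validG M; rewrite model_contents //= orbF => /(_ isT); apply/negP.
rewrite negb_or; apply/andP; split.
- apply: model_colour => [i _|i j].
    rewrite /col; case: ifP => _; first by lia.
    case: ifP => [|_]; first by rewrite -index_mem szt => /leq_ltn_trans; apply.
    by case: ifP => [|_]; [rewrite -index_mem szW ltn_predRL|lia].
  rewrite /= => /orP[ijG|/andP[ijG /andP[ltij ltj]]]; have nuv := notuv _ _ _ ijG.
    have {ijG} ijT : (i, j) \in unzip1 T by apply: (map_f fst (Hp _ ijG)).
    have [/= _ _ neij swij] := goodT _ ijT; have /andP[/= it jt] := mem_touched ijT.
    rewrite /col it jt; case: ifP => iuv; case: ifP => juv //; last first.
      by rewrite eqSS index_neq.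
    (* With both ends among [u] and [v], the pair is the forgotten [(u, v)] or its reverse, and the
       reverse of an answered pair is never itself answered. *)
    have nvu : (j, i) != (u, v) by apply: contraNneq swij => E; rewrite /swap E.
    move: iuv juv neij nuv nvu; rewrite !inE.
    by do 2![case/orP=> /eqP->]; rewrite ?eqxx.
  have jcl : j \in cl by rewrite -index_mem szcl.
  have icl : i \in cl by rewrite -index_mem szcl (ltn_trans ltij).
  have neij : i != j by apply: contraTneq ltij => ->; rewrite ltnn.
  case: (in_cl _ icl) (in_cl _ jcl) => [iuv|iW] [juv|jW].
  + by move: nuv; rewrite (uvE i j iuv juv ltij) eqxx.
  + by rewrite (col_uv i) // col_W.
  + by rewrite (col_uv j) // col_W.
  + by rewrite !col_W // eqSS index_neq.
- apply: model_clique => [l ltl|l m /andP[ltlm ltm]].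
    have : nth 0 cl l \in cl by rewrite mem_nth ?szcl.
    by rewrite !inE => /or3P[/eqP->|/eqP->|/HW[]].
  set i := nth 0 cl l; set j := nth 0 cl m.
  have ltl := ltn_trans ltlm ltm.
  have icl : i \in cl by rewrite mem_nth ?szcl.
  have jcl : j \in cl by rewrite mem_nth ?szcl.
  have Ei : index i cl = l by rewrite index_uniq ?szcl.
  have Ej : index j cl = m by rewrite index_uniq ?szcl.
  have neij : i != j by rewrite nth_uniq ?szcl // ltn_eqF.
  have Kij : K (i, j).
    by rewrite -[K _]/(index i cl < index j cl < k.+1) Ei Ej ltlm.
  rewrite -[model _ _ _ _ _]/((((i, j), Some false) \in contents G)
    || (((i, j), None) \in contents G) && ~~ K (i, j)) Kij andbF orbF.
  apply/negP => ijG.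
  (* A recorded q in the clique, being no loop, comes from an answered pair, so both ends are
     touched. The pair is then [(u, v)], which is forgotten. *)
  have touch e : e \in unzip1 T -> e = (i, j) \/ e = (j, i) -> False.
    move=> /mem_touched/andP[t1 t2] E.
    have [it jt] : i \in tch /\ j \in tch by case: E t1 t2 => ->.
    have := notuv _ _ _ ijG; rewrite uvE ?eqxx ?Ei ?Ej //; exact: touched_cl.
  case/or3P: (Hq _ ijG) => [/=|ijT|swT]; first by rewrite (negPf neij).
    by apply: (touch (i, j)); [apply: (map_f fst ijT)|left].
  by apply: (touch _ swT); right.
Qed.

(** A remembered queried edge is not open. Its status stems from [T], since loops and reversed pairs
    are excluded for queried edges, and answers in [T] are unique. *)
Lemma answer_remembered n k T G e b :
  (size T).*2 < k -> (size T).*2 + k < n -> good_answers n T -> consistent n T G ->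
  valid (G, [:: succedent n k]) -> (e, b) \in T -> (e, Some b) \in contents G.
Proof.
move=> ltk ltn gT cG vG ebT; have eT : e \in unzip1 T by apply: (map_f fst ebT).
have /mapP[[e' st] stG /= E] := answered_edge_remembered ltk ltn gT cG vG eT.
rewrite -{e'}E in stG; case: st stG => [[]|] stG.
- by rewrite (uniq_unzip1_inj gT.1 ebT (consistent_p cG stG)).
- case/or3P: (consistent_q cG stG) => [|efT|swT].
  + by have [_ _ /negPf->] := gT.2 _ eT.
  + by rewrite (uniq_unzip1_inj gT.1 ebT efT).
  + by have [_ _ _ /negP] := gT.2 _ eT.
- by have /negP := consistent_open cG eT.
Qed.

(** Against the colour side [K] is empty: p-edges join touched vertices only, which get distinct
    colours. Against the clique side [K] is full: a q-edge is a loop or touched, so [k.+1] untouched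
    vertices form a clique. *)
Lemma uncommitted n k T G D :
  (size T).*2 < k -> (size T).*2 + k < n -> good_answers n T -> consistent n T G ->
  D \in [:: [:: colour_side n k]; [:: clique_side n k]; [::]] -> ~ valid (G, D).
Proof.
move=> ltk ltn [uT goodT] consG; have [okG _ _ Hp Hq _] := consG.
have := size_touched T; set tch := touched T => szt.
have refute K col cl f : ~~ eval (model (contents G) K col cl) f -> ~ valid (G, [:: f]).
  by move=> vf /(_ _ (model_contents K col cl okG)); rewrite /= orbF (negPf vf).
rewrite !inE => /or3P[]/eqP->.
- apply: (@refute pred0 (fun x => if x \in tch then index x tch else 0) [::] _).
  apply: model_colour => [i _|i j].
    by case: ifP => [|_]; [rewrite -index_mem szt => /ltn_trans; apply|lia].
  rewrite /= andbF orbF => /Hp ijT; have {}ijT : (i, j) \in unzip1 T by apply: (map_f fst ijT).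
  have [/= _ _ neij _] := goodT _ ijT; have /andP[/= it jt] := mem_touched ijT.
  by rewrite it jt; apply: contraNN neij => /eqP E; apply/eqP/(index_inj 0 it jt E).
- have [|W [szW uW HW]] := @fresh_vertices n k.+1 tch; first by lia.
  apply: (@refute predT (fun=> 0) W _); apply: model_clique => [l ltl|l m /andP[ltlm ltm]].
    by have [] := HW (nth 0 W l); first by rewrite mem_nth ?szW.
  set i := nth 0 W l; set j := nth 0 W m; have ltl := ltn_trans ltlm ltm.
  have iW : i \in W by rewrite mem_nth ?szW.
  have neij : i != j by rewrite nth_uniq ?szW // ltn_eqF.
  rewrite /= andbF orbF; apply/negP => /Hq /or3P[/=|ijT|swT]; first by rewrite (negPf neij).
    have := mem_touched (map_f fst ijT : (i, j) \in unzip1 T).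
    by case/andP => /(negP (HW _ iW).2).
  have := mem_touched swT; rewrite /= => /andP[_ /(negP (HW _ iW).2)] //.
- move=> /(_ (model (contents G) pred0 (fun=> 0) [::])).
  by rewrite model_contents // => /(_ isT).
Qed.

Lemma consistent_perm n T G G' c :
  consistent n T G -> all edge_formula G' ->
  perm_eq (contents G) (contents G' ++ c) -> consistent n T G'.
Proof.
move=> [okG uG ltG Hp Hq Hopen] okG' pGG'.
have sub : {subset contents G' <= contents G}.
  by move=> x xG'; rewrite (perm_mem pGG') mem_cat xG'.
split=> // [|e|e /sub/Hp|e /sub/Hq|e /Hopen] //.
- by move: uG; rewrite (perm_uniq (perm_map fst pGG')) map_cat cat_uniq => /and3P[].
- by case/mapP=> x /sub xG ->; apply: ltG; apply: map_f.
- by apply: contraNN => /sub.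
Qed.

(** Covers both kinds of query: a free one, where [T'] gains the answer to [e], and a forced one,
    where [T'] is [T] and [b] is false. *)
Lemma consistent_answer n T T' G G' e b c :
  consistent n T G -> all edge_formula G' ->
  perm_eq (contents G) ((e, None) :: c) ->
  perm_eq (contents G') ((e, Some b) :: c) ->
  {subset T <= T'} -> {subset unzip1 T' <= e :: unzip1 T} ->
  (if b then (e, true) \in T'
   else [|| e.1 == e.2, (e, false) \in T' | swap e \in unzip1 T']) ->
  consistent n T' G'.
Proof.
move=> [okG uG ltG Hp Hq Hopen] okG' pG pG' sT sT' Hb.
have pfst : perm_eq (unzip1 (contents G')) (unzip1 (contents G)).
  by rewrite (perm_trans (perm_map fst pG')) // perm_sym (perm_map fst pG).
have inG' f st : (f, st) \in contents G' ->
    (f, st) = (e, Some b) \/ (f, st) \in contents G.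
  by rewrite (perm_mem pG') (perm_mem pG) !inE => /orP[/eqP|->]; [left|right; rewrite orbT].
split=> // [|f|f|f|f fT'].
- by rewrite (perm_uniq pfst).
- by rewrite (perm_mem pfst); apply: ltG.
- by case/inG' => [[-> E]|/Hp/sT//]; rewrite -E in Hb.
- case/inG' => [[-> E]|/Hq/or3P[->//|/sT->|swT]]; first by rewrite -E in Hb.
    by rewrite orbT.
  case/mapP: swT => a /sT aT' ->; apply/or3P/Or33; exact: map_f.
- apply/negP => fG'; have := perm_uniq pfst; rewrite uG => uG'.
  have [[_ //]|fG] := inG' _ _ fG'.
  have : f != e.
    apply: contraTneq fG' => ->; apply/negP => eG'.
    have eG'b : (e, Some b) \in contents G' by rewrite (perm_mem pG') mem_head.
    by have := uniq_unzip1_inj uG' eG' eG'b.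
  by move: (sT' _ fT'); rewrite inE => /orP[/eqP->|/Hopen/negP//]; rewrite eqxx.
Qed.

Lemma good_answers_cons n T e b :
  good_answers n T -> e.1 < n -> e.2 < n -> e.1 != e.2 -> e \notin unzip1 T ->
  swap e \notin unzip1 T -> good_answers n ((e, b) :: T).
Proof.
move=> [uT HT] lt1 lt2 ne eT swT; split; first by rewrite /= eT.
have swapK f : swap (swap f) = f by case: f.
move=> f; rewrite /= !inE => /orP[/eqP->|fT].
  split=> //; rewrite negb_or swT andbT.
  by apply: contraNneq ne => /(congr1 fst) /= ->.
have [? ? ? sw] := HT f fT; split=> //; rewrite negb_or sw andbT.
by apply: contraNneq swT => <-; rewrite swapK.
Qed.

(* Two lines reached through different answers to the same free query are
   distinct, since both still remember the answer. *)
Lemma adversary_lines n k pf :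
  closed_lines CFLew_rule pf -> {in pf, forall s, valid s} ->
  forall i m T G, i < size pf -> nth ([::], [::]) pf i = (G, [:: succedent n k]) ->
    good_answers n T -> consistent n T G ->
    (size T + m).*2 < k -> (size T + m).*2 + k < n ->
  exists N : seq sequent, [/\ uniq N, {subset N <= pf}, size N = 2 ^ m &
    {in N, forall s, uniq (unzip1 (contents s.1)) /\
      forall e b, (e, b) \in T -> (e, Some b) \in contents s.1}].
Proof.
move=> cpf vpf; elim/ltn_ind=> i IH m T G lti Ei gT cG ltk ltn.
have vG : valid (G, [:: succedent n k]) by rewrite -Ei; apply/vpf/mem_nth.
have ltTk : (size T).*2 < k by move: ltk; lia.
have ltTn : (size T).*2 + k < n by move: ltn; lia.
case: m => [|m] in ltk ltn *.
  exists [:: (G, [:: succedent n k])]; split=> // s; rewrite inE => /eqP->.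
    by rewrite -Ei mem_nth.
  split=> [|e b]; first exact: consistent_uniq cG.
  exact: answer_remembered vG.
have [ps r sub] := cpf i lti; rewrite Ei in r.
(* Premises occur at smaller indices, so the induction hypothesis applies to them. *)
have {}IH p : p \in ps -> forall m T G, p = (G, [:: succedent n k]) -> _ :=
  fun pin m T G Ep => IH (index p pf) (index_ltn (sub p pin)) m T G
    (leq_trans (index_ltn (sub p pin)) (ltnW lti))
    (etrans (nth_index _ (mem_take (sub p pin))) Ep).
have vps p : p \in ps -> valid p by move=> /sub/mem_take; apply: vpf.
case: (CFLew_rule_edges r (consistent_edge cG)) => //.
(* Information may be lost, but [T] and the budget [m] are kept. *)
- case=> G' [c [G'ps okG' pG']].
  by apply: (IH _ G'ps m.+1 T G') => //; apply: consistent_perm pG'.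
- case=> e [c [G1 [G0 [in1 in0 /andP[ok1 ok0] pG [p1 p0]]]]].
  have eG : (e, None) \in contents G by rewrite (perm_mem pG) mem_head.
  have /andP[lt1 lt2] := consistent_lt cG (map_f fst eG).
  have eT : e \notin unzip1 T.
    by apply: contraTN eG => /(consistent_open cG).
  (* A loop or a reversed pair is answered q without spending budget. *)
  have [forced|] := boolP ((e.1 == e.2) || (swap e \in unzip1 T)).
    apply: (IH _ in0 m.+1 T G0) => //.
    apply: (consistent_answer cG ok0 pG p0) => // [f fT|]; first by rewrite inE fT orbT.
    by case/orP: forced => ->; rewrite ?orbT.
  rewrite negb_or => /andP[ne swT].
  have branch b G' : (G', [:: succedent n k]) \in ps -> all edge_formula G' ->
      perm_eq (contents G') ((e, Some b) :: c) ->
      exists N : seq sequent, [/\ uniq N, {subset N <= pf}, size N = 2 ^ m &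
        {in N, forall s, uniq (unzip1 (contents s.1)) /\
          forall f b', (f, b') \in (e, b) :: T -> (f, Some b') \in contents s.1}].
    move=> inG' okG' pG'; apply: (IH _ inG' m ((e, b) :: T) G') => //.
    - exact: good_answers_cons.
    - apply: (consistent_answer cG okG' pG pG') => // [a aT|].
        by rewrite inE aT orbT.
      by case: (b); rewrite mem_head ?orbT.
    - by move: ltk; rewrite /= addSnnS.
    - by move: ltn; rewrite /= addSnnS.
  have [N1 [u1 s1 z1 H1]] := branch true G1 in1 ok1 p1.
  have [N0 [u0 s0 z0 H0]] := branch false G0 in0 ok0 p0.
  exists (N1 ++ N0); split.
  (* A common line would carry both statuses of [e], against the uniqueness of its edges. *)
  + rewrite cat_uniq u1 u0 andbT; apply/hasPn => s sN0; apply/negP => sN1.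
    have [us /(_ e true (mem_head _ _)) st] := H1 s sN1.
    have [_ /(_ e false (mem_head _ _)) sf] := H0 s sN0.
    by have := uniq_unzip1_inj us st sf.
  + by move=> s; rewrite mem_cat => /orP[/s1|/s0].
  + by rewrite size_cat z1 z0 expnS mul2n addnn.
  + move=> s; rewrite mem_cat => /orP[/H1|/H0][us Hs]; split=> // f b' fT;
      by apply: Hs; rewrite inE fT orbT.
- by case=> D /vps vD inD; case: (uncommitted ltTk ltTn gT cG inD vD).
Qed.

(** * From the last line of a proof to the first query *)

(** The last line comes from [impR] or from weakening of the empty sequent; soundness rules out the
    latter. *)
Lemma CFLew_rule_Imp ps A B :
  CFLew_rule ps ([::], [:: Imp A B]) ->
  ([:: A], [:: B]) \in ps \/ ([::], [::]) \in ps.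
Proof.
have nil_cat (T : Type) (G S : seq T) x : [::] = G ++ x :: S -> False by case: G.
move E: (_, _) => s H; case: H E => [{}ps {}s []|G S D a|G D L a].
all: try by [].
all: try by [move=> > [E]; case: (nil_cat _ _ _ _ E)].
all: try by [move=> [E]; case: (nil_cat _ _ _ _ E)].
all: try by [move=> > [_ E]; case: (cat_cons_eq1 E)].
- by move=> G P S D L a b [E _]; rewrite catA in E; case: (nil_cat _ _ _ _ E).
- by move=> G D a b [<- -> -> <-]; left; exact: mem_head.
- by move=> [<- E]; case: (cat_cons_eq1 E) => -> -> _; right; exact: mem_head.
Qed.

Lemma closed_lines_valid pf :
  closed_lines CFLew_rule pf -> {in pf, forall s, valid s}.
Proof.
move=> cpf s /(nthP ([::], [::]))[i lti <-]; elim/ltn_ind: i lti => i IH lti.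
have [ps r sub] := cpf i lti; apply: CFLew_rule_sound r _ => p /sub pin.
rewrite -(nth_index ([::], [::]) (mem_take pin)); have lt := index_ltn pin.
by apply: IH => //; apply: ltn_trans lti.
Qed.

Definition edges (n : nat) : seq (nat * nat) :=
  [seq (i, j) | i <- iota 0 n, j <- iota 0 n].

Lemma edge_choicesE n :
  edge_choices n = [seq (vp e.1 e.2, vq e.1 e.2) | e <- edges n].
Proof. by rewrite map_allpairs. Qed.

Lemma edge_formula_choices es :
  edge_formula (choices [seq (vp e.1 e.2, vq e.1 e.2) | e <- es]).
Proof.
elim: es => // e [|e' es] IH; first by rewrite /= !eqxx.
by move: IH; rewrite /= !eqxx.
Qed.

Lemma content_choices es :
  content (choices [seq (vp e.1 e.2, vq e.1 e.2) | e <- es]) = [seq (e, None) | e <- es].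
Proof.
elim: es => // -[i j] [|e' es] //= IH.
by congr cons.
Qed.

Lemma consistent_start n : consistent n [::] [:: choices (edge_choices n)].
Proof.
have Ec : contents [:: choices (edge_choices n)] = [seq (e, None) | e <- edges n].
  by rewrite /contents /= cats0 edge_choicesE content_choices.
have Eu : unzip1 (contents [:: choices (edge_choices n)]) = edges n.
  by rewrite Ec; elim: (edges n) => //= e es ->.
split=> [||e|e|e|e //].
- by rewrite all_seq1 edge_choicesE edge_formula_choices.
- by rewrite Eu; apply: allpairs_uniq; rewrite ?iota_uniq // => -[? ?] [].
- by rewrite Eu => /allpairsP[[i j] /= []]; rewrite !mem_iota /= => ? ? -> /=; apply/andP.
- by rewrite Ec => /mapP[].
- by rewrite Ec => /mapP[].
Qed.

(** In the premise of the final [impR] all edges are open, so the adversary starts there with no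
    answers and budget [t]. *)
Lemma proof_size_lower_bound n k t pf :
  t.*2 < k -> t.*2 + k < n -> is_proof CFLew_rule pf (Theta n k) -> 2 ^ t <= size pf.
Proof.
move=> ltk ltn [cpf lpf]; have vpf := closed_lines_valid cpf.
have sz : (size pf).-1 < size pf by case: pf lpf {cpf vpf}.
have [ps r sub] := cpf _ sz; rewrite nth_last lpf ThetaE in r.
have [] := CFLew_rule_Imp r => /sub/mem_take; last by move=> /vpf/(_ (fun=> true) isT).
move=> /(nthP ([::], [::]))[i lti Ei].
have [|N [uN sN <- _]] := adversary_lines cpf vpf (m := t) (T := [::]) lti Ei _
  (consistent_start n) ltk ltn.
  by split.
exact: uniq_leq_size.
Qed.

(** * Length of Theta and choice of the parameters *)

(** A connective with its parentheses costs 3 symbols; the summand 1 covers the empty list. *)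
Lemma bigop_length op e s m :
  (forall a b, formula_length (op a b) = formula_length a + formula_length b + 3) ->
  formula_length e = 1 -> {in s, forall f, formula_length f <= m} ->
  formula_length (iter_conn op e s) <= size s * (m + 3) + 1.
Proof.
move=> Hop He; elim: s => [|a [|b s] IH] Hs; first by rewrite /= He.
  by have := Hs a (mem_head _ _); rewrite /=; lia.
rewrite [iter_conn _ _ _]/= -/(iter_conn op e (b :: s)) Hop.
have := Hs a (mem_head _ _); have : formula_length (iter_conn op e (b :: s))
    <= size (b :: s) * (m + 3) + 1.
  by apply: IH => f fs; apply: Hs; rewrite inE fs orbT.
rewrite [size (b :: s)]/= [size (a :: b :: s)]/= !mulSn.
lia.
Qed.

Lemma choices_length cs : formula_length (choices cs) <= size cs * 16 + 1.
Proof.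
(* [choice1] has 13 symbols, and 16 is 13 + 3. *)
rewrite -(size_map (fun c => choice1 c.1 c.2) cs); apply: (bigop_length (m := 13)) => // f.
by case/mapP=> c _ ->.
Qed.

Lemma alpha_length n k :
  formula_length (alpha n k) <= n * (k * 4 + 4) + n * n * (k * 12 + 4) + 5.
Proof.
have A : formula_length (bigOr [seq bigAnd [seq Var (vs' i l) | l <- iota 0 k]
    | i <- iota 0 n]) <= n * (k * 4 + 1 + 3) + 1.
  rewrite -[X in X * _](size_iota 0 n) -(size_map (fun i =>
    bigAnd [seq Var (vs' i l) | l <- iota 0 k]) (iota 0 n)).
  apply: bigop_length => // f /mapP[i _ ->].
  rewrite -[X in X * 4](size_iota 0 k) -(size_map (fun l => Var (vs' i l)) (iota 0 k)).
  by apply: (bigop_length (m := 1)) => // g /mapP[l _ ->].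
have B : formula_length (bigOr [seq bigOr [seq And (And (Var (vs i l)) (Var (vs j l)))
      (Var (vp i j)) | l <- iota 0 k] | i <- iota 0 n, j <- iota 0 n])
    <= n * n * (k * 12 + 1 + 3) + 1.
  set s := flatten _; have <- : size s = n * n by rewrite size_allpairs !size_iota.
  apply: bigop_length => // f /allpairsP[[i j] [_ _ ->]] /=.
  rewrite -[X in X * 12](size_iota 0 k) -(size_map (fun l => And (And (Var (vs i l))
    (Var (vs j l))) (Var (vp i j))) (iota 0 k)).
  by apply: (bigop_length (m := 9)) => // g /mapP[l _ ->].
rewrite [formula_length _]/=; lia.
Qed.

Lemma beta_length n k :
  formula_length (beta n k) <= k * (n * 4 + 4) + n * n * (k * k * 12 + 4) + 5.
Proof.
have A : formula_length (bigOr [seq bigAnd [seq Var (vr' i l) | i <- iota 0 n]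
    | l <- iota 0 k]) <= k * (n * 4 + 1 + 3) + 1.
  rewrite -[X in X * _](size_iota 0 k) -(size_map (fun l =>
    bigAnd [seq Var (vr' i l) | i <- iota 0 n]) (iota 0 k)).
  apply: bigop_length => // f /mapP[l _ ->].
  rewrite -[X in X * 4](size_iota 0 n) -(size_map (fun i => Var (vr' i l)) (iota 0 n)).
  by apply: (bigop_length (m := 1)) => // g /mapP[i _ ->].
have B : formula_length (bigOr [seq bigOr [seq And (And (Var (vr i l)) (Var (vr j m)))
      (Var (vq i j)) | l <- iota 0 k, m <- iota l.+1 (k - l.+1)]
      | i <- iota 0 n, j <- iota 0 n]) <= n * n * (k * k * 12 + 1 + 3) + 1.
  set s := flatten _; have <- : size s = n * n by rewrite size_allpairs !size_iota.
  apply: bigop_length => // f /allpairsP[[i j] [_ _ ->]] /=.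
  set r := flatten _.
  have ler : size r <= k * k.
    rewrite size_allpairs_dep -[X in X * k](size_iota 0 k).
    elim: (iota 0 k) => //= l ls IHls.
    by rewrite size_iota mulSn leq_add // leq_subr.
  apply: leq_trans (_ : size r * 12 + 1 <= _); last by rewrite leq_add2r leq_mul2r ler orbT.
  by apply: (bigop_length (m := 9)) => // g /allpairsPdep[l [m [_ _ ->]]].
rewrite [formula_length _]/=; lia.
Qed.

(** The leading term comes from beta, which ranges over two vertices and two clique indices, each
    with at most [n] values. *)
Lemma Theta_length n k :
  k < n -> formula_length (Theta n k) <= 256 * n ^ 4.
Proof.
have lenI a b : formula_length (Imp a b) = formula_length a + formula_length b + 3 by [].
have lenO a b : formula_length (Or a b) = formula_length a + formula_length b + 3 by [].
move=> ltkn; rewrite ThetaE lenI lenO !lenI.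
have := choices_length (edge_choices n).
have := choices_length (colour_choices n k).
have := choices_length (clique_choices n k.+1).
have := alpha_length n k; have := beta_length n k.+1.
rewrite /edge_choices /colour_choices /clique_choices !size_allpairs !size_iota.
have n1 : 1 <= n by apply: leq_trans ltkn.
have le2 : n <= n * n by rewrite leq_pmulr.
have le3 : n * n <= n * n * n by rewrite leq_pmulr.
have le4 : n * n * n <= n * n * n * n by rewrite leq_pmulr.
have a1 : n * k <= n * n by rewrite leq_mul // ltnW.
have a2 : n * n * k <= n * n * n by rewrite leq_mul // ltnW.
have a3 : n * k.+1 <= n * n by rewrite leq_mul.
have a4 : n * n * (k.+1 * k.+1) <= n * n * n * n by rewrite -[X in _ <= X]mulnA !leq_mul.
rewrite !expnS expn0 muln1; lia.
Qed.

(** [t] is the largest number with [t.*2 < Nat.sqrt n]. The threshold 33 for the root gives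
    [16 <= t], and [n] is below the square of [Nat.sqrt n + 1 <= 2 * t + 3 <= 4 * t]. *)
Lemma sqrt_bounds n :
  33 * 33 <= n -> let t := (Nat.sqrt n).-1./2 in
  [/\ t.*2 < Nat.sqrt n, t.*2 + Nat.sqrt n < n, Nat.sqrt n < n, 16 <= t &
      n <= 16 * t ^ 2].
Proof.
move=> len t; have := PeanoNat.Nat.sqrt_spec n (PeanoNat.Nat.le_0_l n).
have := @PeanoNat.Nat.sqrt_le_mono (33 * 33) n (elimT ssrnat.leP len).
rewrite PeanoNat.Nat.sqrt_square => /ssrnat.leP.
move: @t; set k := Nat.sqrt n => t lek [/ssrnat.leP lo /ssrnat.leP hi].
have Et : k.-1 <= t.*2.+1 <= k by rewrite /t; lia.
have lt33 : 33 * k <= k * k by rewrite leq_mul2r lek orbT.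
have hi' : k.+1 * k.+1 <= (t.*2 + 3) * (t.*2 + 3) by rewrite leq_mul //; lia.
have lt16 : 16 * t <= t * t by rewrite leq_mul2r; lia.
have {}lo : k * k <= n by [].
have {}hi : n < k.+1 * k.+1 by [].
rewrite expnS expn1; split; lia.
Qed.

Lemma size_le_proof_length pf : size pf <= proof_length pf.
Proof.
elim: pf => // s pf IH; rewrite /proof_length /= -/(proof_length pf).
by rewrite -add1n leq_add // /sequent_length; lia.
Qed.

(** As [16 <= t], both [n <= 16 * t ^ 2 <= t ^ 3] and [256 <= t ^ 2] hold, so
    [256 * n ^ 4 <= t ^ 2 * t ^ 12]. *)
Lemma Theta_sqrt_length n :
  33 * 33 <= n -> formula_length (Theta_sqrt n) <= (Nat.sqrt n).-1./2 ^ 14.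
Proof.
move=> len; have [_ _ ltkn let_ le_n] := sqrt_bounds len; set t := _./2 in let_ le_n *.
apply: leq_trans (Theta_length ltkn) _.
have le3 : n <= t ^ 3 by apply: leq_trans le_n _; rewrite [t ^ 3]expnS leq_mul2r let_ orbT.
rewrite (_ : t ^ 14 = t ^ 2 * (t ^ 3) ^ 4); last by rewrite -expnM -expnD.
apply: leq_mul; last by rewrite leq_exp2r.
by rewrite (_ : 256 = 16 ^ 2) // leq_exp2r.
Qed.

(** * Real exponents and the final bounds *)

Local Open Scope ring_scope.

Lemma powR_root_le (R : realType) (x y m : nat) :
  (0 < m)%N -> (x <= y ^ m)%N -> x%:R `^ (m%:R^-1) <= y%:R :> R.
Proof.
move=> m0 le; apply: (@le_trans _ _ ((y ^ m)%:R `^ (m%:R^-1))).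
  by apply: ge0_ler_powR; rewrite ?nnegrE ?ler0n ?ler_nat // invr_ge0.
by rewrite natrX -powR_mulrn // -powRrM divff ?powRr1 // pnatr_eq0 -lt0n.
Qed.

Lemma exp2_le_nat (R : realType) (x : R) (t m : nat) :
  x <= t%:R -> (2 ^ t <= m)%N -> 2 `^ x <= m%:R.
Proof.
move=> lex lem; apply: (@le_trans _ _ (2 `^ t%:R)); first by rewrite ler_powR ?ler1n.
by rewrite powR_mulrn // -natrX ler_nat.
Qed.

Theorem theorem6p6 (R : realType) :
  (forall n k : nat, (1 <= k <= n)%N -> provable CFLe_rule (Theta n k))
  /\ (exists2 c : R, 0 < c & exists n0 : nat, forall n : nat, (n0 <= n)%N ->
        forall pf : seq sequent, is_proof CFLew_rule pf (Theta_sqrt n) ->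
          2 `^ (c * n%:R `^ (4^-1)) <= (size pf)%:R)
  /\ (exists2 eps : R, 0 < eps & exists n0 : nat, forall n : nat, (n0 <= n)%N ->
        forall pf : seq sequent, is_proof CFLew_rule pf (Theta_sqrt n) ->
          2 `^ ((formula_length (Theta_sqrt n))%:R `^ eps)
            <= (proof_length pf)%:R).
Proof.
split; first by move=> n k _; apply/provable_of_derivable/derivable_Theta.
have lower n pf : (33 * 33 <= n)%N -> is_proof CFLew_rule pf (Theta_sqrt n) ->
    (2 ^ (Nat.sqrt n).-1./2 <= size pf)%N.
  by move=> /sqrt_bounds[ltk ltn _ _ _]; apply: proof_size_lower_bound.
split.
  (* Half the fourth root of [n] is at most [t], because [n <= 16 * t ^ 2 <= (2 * t) ^ 4]. *)
  exists 2^-1; first by rewrite invr_gt0.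
  exists (33 * 33)%N => n len pf /(lower _ _ len); apply: exp2_le_nat.
  have [_ _ _ let_ le_n] := sqrt_bounds len; set t := _./2 in let_ le_n *.
  rewrite mulrC ler_pdivrMr // -natrM; apply: powR_root_le => //.
  apply: leq_trans le_n _; rewrite expnMn mulnC leq_mul2r orbC /=.
  by rewrite leq_exp2l // (leq_trans _ let_).
(* The formula has length at most [t ^ 14], so its 14th root is at most [t]. *)
exists 14^-1; first by rewrite invr_gt0.
exists (33 * 33)%N => n len pf /(lower _ _ len) le_pf.
apply: exp2_le_nat (leq_trans le_pf (size_le_proof_length pf)).
by apply: powR_root_le => //; exact: Theta_sqrt_length.
Qed.
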